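(* Consider the semi-discrete approximation $$\frac{d\mathbf{E}_z}{dt}=-(D_x\otimes I_y)\mathbf{H}_y+(I_x\otimes D_y)\mathbf{H}_x+\mathbf{H}_x^*-\boldsymbol{\sigma}\mathbf{E}_z-\left((P_x^{-1}B_x^+\otimes I_y)\mathbf{E}_z-(P_x^{-1}B_x^-\otimes I_y)\mathbf{H}_y\right)-\left((I_x\otimes P_y^{-1}B_y^+)\mathbf{E}_z+(I_x\otimes P_y^{-1}B_y^-)\mathbf{H}_x\right),$$ $$\frac{d\mathbf{H}_y}{dt}=-(D_x\otimes I_y)\mathbf{E}_z-\boldsymbol{\sigma}\mathbf{H}_y,\qquad \frac{d\mathbf{H}_x}{dt}=(I_x\otimes D_y)\mathbf{E}_z,$$ $$\frac{d\mathbf{H}_x^*}{dt}=\boldsymbol{\sigma}\left((I_x\otimes D_y)\mathbf{H}_x-\theta\left((I_x\otimes P_y^{-1}B_y^+)\mathbf{E}_z+(I_x\otimes P_y^{-1}B_y^-)\mathbf{H}_x\right)\right),$$ or its second order form $$\frac{d^2\mathbf{E}_z}{dt^2}=-(P_x^{-1}D_x^T\otimes I_y)(P_x\otimes I_y)\left((D_x\otimes I_y)\mathbf{E}_z+\boldsymbol{\sigma}\mathbf{H}_y\right)-(I_x\otimes P_y^{-1}D_y^T)(I_x\otimes P_y)\left((I_x\otimes D_y)\mathbf{E}_z+\boldsymbol{\sigma}\mathbf{H}_x\right)-\boldsymbol{\sigma}\frac{d\mathbf{E}_z}{dt}$$ $$\qquad+(1-\theta)\boldsymbol{\sigma}(I_x\otimes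 P_y^{-1}B_y^-)\mathbf{H}_x-\left(P_x^{-1}B_x^+\otimes I_y+I_x\otimes P_y^{-1}B_y^+\right)\frac{d\mathbf{E}_z}{dt}-\theta\boldsymbol{\sigma}(I_x\otimes P_y^{-1}B_y^+)\mathbf{E}_z,$$ $$\frac{d\mathbf{H}_y}{dt}=-(D_x\otimes I_y)\mathbf{E}_z-\boldsymbol{\sigma}\mathbf{H}_y,\qquad \frac{d\mathbf{H}_x}{dt}=(I_x\otimes D_y)\mathbf{E}_z.$$ If $\theta=1$, then the quantity $$\mathcal{E}^{(1)}_{h\sigma}(t)=\left\|\frac{d\mathbf{E}_z}{dt}\right\|^2_{\mathbf{P}_{xy}}+\left\|(D_x\otimes I_y)\mathbf{E}_z+\boldsymbol{\sigma}\mathbf{H}_y\right\|^2_{\mathbf{P}_{xy}}+\left\|(I_x\otimes D_y)\mathbf{E}_z+\boldsymbol{\sigma}\mathbf{H}_x\right\|^2_{\mathbf{P}_{xy}}+\|\boldsymbol{\sigma}\mathbf{H}_y\|^2_{\mathbf{P}_{xy}}+\|\boldsymbol{\sigma}\mathbf{H}_x\|^2_{\mathbf{P}_{xy}}$$ $$\qquad+\theta\,\mathbf{E}_z^T\left(P_x\Sigma\otimes B_y^+\right)\mathbf{E}_z+2\int_0^t\frac{d\mathbf{E}_z}{dt'}^T\left(B_x^+\otimes P_y+P_x\otimes B_y^+\right)\frac{d\mathbf{E}_z}{dt'}\,dt'$$ is an energy (i.e. it is nonnegative for $t\ge 0$), and all solutions of either discrete system satisfy $$\frac{d}{dt}\sqrt{\mathcal{E}^{(1)}_{h\sigma}(t)}\le\sigma_\infty\sqrt{\mathcal{E}^{(1)}_{h\sigma}(t)},\qquad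 \sigma_\infty=\max_x\sigma(x).$$
   Context: Summation-by-parts (SBP) operators: for $\xi\in\{x,y\}$, $N_\xi\ge2$ is the number of grid points, $I_\xi$ the $N_\xi\times N_\xi$ identity, and $D_\xi=P_\xi^{-1}Q_\xi$ is a real $N_\xi\times N_\xi$ matrix (approximating $\partial/\partial\xi$) with $P_\xi$ diagonal and positive definite and $Q_\xi+Q_\xi^T=E_{R\xi}-E_{L\xi}$, where $E_{L\xi}=\mathrm{diag}(1,0,\dots,0)$, $E_{R\xi}=\mathrm{diag}(0,\dots,0,1)$. Write $B_\xi^{\pm}=E_{R\xi}\pm E_{L\xi}$. $\otimes$ is the Kronecker product. $\mathbf{P}_{xy}=P_x\otimes P_y$ and $\|\mathbf{u}\|^2_{\mathbf{P}_{xy}}=\mathbf{u}^T\mathbf{P}_{xy}\mathbf{u}$. Unknowns $\mathbf{E}_z,\mathbf{H}_y,\mathbf{H}_x,\mathbf{H}_x^*$ are functions of $t\ge0$ with values in $\mathbb{R}^{N_xN_y}$ (index ordering: $x$ first factor, $y$ second). The damping function $\sigma(x)\ge0$ is evaluated at the $x$-grid points $x_i$: $\Sigma=\mathrm{diag}(\sigma(x_1),\dots,\sigma(x_{N_x}))$ and $\boldsymbol{\sigma}=\Sigma\otimes I_y$. $\theta$ is a real parameter. An inequality $\frac{d}{dt}\sqrt{\mathcal{E}}\le\sigma_\infty\sqrt{\mathcal{E}}$ is understood as $\frac{d}{dt}\mathcal{E}\le2\sigma_\infty\mathcal{E}$ (equivalent wherever $\mathcal{E}>0$). *)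

(* Defs.v *)
From mathcomp Require Import all_boot all_order all_algebra.
From mathcomp.real_closed Require Import mxtens.
From mathcomp Require Import all_classical all_reals all_analysis.

Set Implicit Arguments.
Unset Strict Implicit.
Unset Printing Implicit Defensive.

Import Order.TTheory GRing.Theory Num.Theory.
Import numFieldNormedType.Exports.

Local Open Scope classical_set_scope.
Local Open Scope ring_scope.

(** The unknowns live on [0, +oo): the difference quotients below only use times
    h + t >= 0, so the derivative at t = 0 is the right derivative, and the
    values of f at negative times play no role.  For t > 0 this is the usual
    derivative, see [ddtE]. *)

Definition ddt_derivable (R : realType) (V : normedModType R)
    (f : R -> V) (t : R) : Prop :=
  cvg (h^-1 *: (f (h + t) - f t) @[h --> within [set h | 0 <= h + t] 0^']).

Definition ddt (R : realType) (V : normedModType R) (f : R -> V) (t : R) : V :=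
  lim (h^-1 *: (f (h + t) - f t) @[h --> within [set h | 0 <= h + t] 0^']).

Lemma ddt_filterE (R : realType) (t : R) : 0 < t ->
  within [set h : R | 0 <= h + t] (0 : R)^' = (0 : R)^'.
Proof.
move=> t0; apply/seteqP; split => A; last exact: cvg_within.
rewrite /within /= => wA; have t_near : \forall h \near (0 : R)^', 0 <= h + t.
  apply: nbhs_dnbhs; near=> h; rewrite -lerBlDr sub0r ltW//.
  by near: h; apply: (open_gt (y := - t)); rewrite /= oppr_lt0.
by apply: filterS2 wA t_near => h; apply.
Unshelve. all: by end_near. Qed.

Lemma ddtE (R : realType) (V : normedModType R) (f : R -> V) (t : R) :
  0 < t -> ddt f t = derive1 f t.
Proof. by move=> t0; rewrite /ddt ddt_filterE. Qed.

Definition posdefmx (R : realType) (N : nat) (P : 'M[R]_N) : Prop :=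
  P^T = P /\ forall v : 'cV[R]_N, v != 0 -> 0 < (v^T *m P *m v) 0 0.

Definition EL (R : realType) (N : nat) : 'M[R]_N :=
  diag_mx (\row_i ((i == 0%N :> nat)%:R)).

Definition ER (R : realType) (N : nat) : 'M[R]_N :=
  diag_mx (\row_i ((i == N.-1 :> nat)%:R)).

Definition Bplus (R : realType) (N : nat) : 'M[R]_N := ER R N + EL R N.

Definition Bminus (R : realType) (N : nat) : 'M[R]_N := ER R N - EL R N.

Record sbp (R : realType) (N : nat) := Sbp {
  sbpP : 'M[R]_N;
  sbpQ : 'M[R]_N;
  sbpP_diag : is_diag_mx sbpP;
  sbpP_posdef : posdefmx sbpP;
  sbpQ_sbp : sbpQ + sbpQ^T = ER R N - EL R N }.

Definition sbpD (R : realType) (N : nat) (S : sbp R N) : 'M[R]_N :=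
  invmx (sbpP S) *m sbpQ S.

(** [tensmx], written [*t], puts the pair (i, j) at position i * Ny + j: the x
    index is the first factor. *)

Definition dampx (R : realType) (Nx : nat) (sigma : R -> R)
    (x : 'I_Nx -> R) : 'M[R]_Nx :=
  diag_mx (\row_i sigma (x i)).

Definition damp (R : realType) (Nx Ny : nat) (sigma : R -> R)
    (x : 'I_Nx -> R) : 'M[R]_(Nx * Ny) :=
  dampx sigma x *t (1%:M : 'M[R]_Ny).

Definition qform (R : realType) (n : nat) (A : 'M[R]_n) (u : 'cV[R]_n) : R :=
  (u^T *m A *m u) 0 0.

Section Systems.
Context (R : realType) (Nx Ny : nat).
Context (Sx : sbp R Nx) (Sy : sbp R Ny).
Context (sigma : R -> R) (x : 'I_Nx -> R) (theta : R).

Let Ix : 'M[R]_Nx := 1%:M.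
Let Iy : 'M[R]_Ny := 1%:M.
Let Px := sbpP Sx.
Let Py := sbpP Sy.
Let Dx := sbpD Sx.
Let Dy := sbpD Sy.
Let Bxp := Bplus R Nx.
Let Bxm := Bminus R Nx.
Let Byp := Bplus R Ny.
Let Bym := Bminus R Ny.
Let sig : 'M[R]_(Nx * Ny) := damp Ny sigma x.

Definition first_order_system
    (Ez Hy Hx Hxs : R -> 'cV[R]_(Nx * Ny)) : Prop :=
  forall t : R, 0 <= t ->
  [/\ ddt_derivable Ez t, ddt_derivable Hy t, ddt_derivable Hx t
    & ddt_derivable Hxs t] /\
  [/\ ddt Ez t =
        - ((Dx *t Iy) *m Hy t) + (Ix *t Dy) *m Hx t + Hxs t - sig *m Ez t
        - (((invmx Px *m Bxp) *t Iy) *m Ez t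
           - ((invmx Px *m Bxm) *t Iy) *m Hy t)
        - ((Ix *t (invmx Py *m Byp)) *m Ez t
           + (Ix *t (invmx Py *m Bym)) *m Hx t),
      ddt Hy t = - ((Dx *t Iy) *m Ez t) - sig *m Hy t,
      ddt Hx t = (Ix *t Dy) *m Ez t
    & ddt Hxs t =
        sig *m ((Ix *t Dy) *m Hx t
                - theta *: ((Ix *t (invmx Py *m Byp)) *m Ez t
                            + (Ix *t (invmx Py *m Bym)) *m Hx t))].

Definition second_order_system (Ez Hy Hx : R -> 'cV[R]_(Nx * Ny)) : Prop :=
  forall t : R, 0 <= t ->
  [/\ ddt_derivable Ez t, ddt_derivable (ddt Ez) t, ddt_derivable Hy t
    & ddt_derivable Hx t] /\
  [/\ ddt (ddt Ez) t =
        - (((invmx Px *m Dx^T) *t Iy) *m (Px *t Iy)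
             *m ((Dx *t Iy) *m Ez t + sig *m Hy t))
        - ((Ix *t (invmx Py *m Dy^T)) *m (Ix *t Py)
             *m ((Ix *t Dy) *m Ez t + sig *m Hx t))
        - sig *m ddt Ez t
        + (1 - theta) *: (sig *m (Ix *t (invmx Py *m Bym)) *m Hx t)
        - ((invmx Px *m Bxp) *t Iy + Ix *t (invmx Py *m Byp)) *m ddt Ez t
        - theta *: (sig *m (Ix *t (invmx Py *m Byp)) *m Ez t),
      ddt Hy t = - ((Dx *t Iy) *m Ez t) - sig *m Hy t
    & ddt Hx t = (Ix *t Dy) *m Ez t].

Definition energy1 (Ez Hy Hx : R -> 'cV[R]_(Nx * Ny)) (t : R) : R :=
  qform (Px *t Py) (ddt Ez t)
  + qform (Px *t Py) ((Dx *t Iy) *m Ez t + sig *m Hy t)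
  + qform (Px *t Py) ((Ix *t Dy) *m Ez t + sig *m Hx t)
  + qform (Px *t Py) (sig *m Hy t)
  + qform (Px *t Py) (sig *m Hx t)
  + theta * qform ((Px *m dampx sigma x) *t Byp) (Ez t)
  + 2 * \int[lebesgue_measure]_(t' in `[0, t])
          qform (Bxp *t Py + Px *t Byp) (ddt Ez t').

End Systems.

(* Main.v *)
Require Import Defs.
From mathcomp Require Import all_boot all_order all_algebra.
From mathcomp.real_closed Require Import mxtens.
From mathcomp Require Import all_classical all_reals all_analysis.
From mathcomp Require Import ring lra.

Set Implicit Arguments.
Unset Strict Implicit.
Unset Printing Implicit Defensive.

Import Order.TTheory GRing.Theory Num.Theory.
Import numFieldNormedType.Exports.

Local Open Scope classical_set_scope.
Local Open Scope ring_scope.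

(** The estimate is an energy argument.  With theta = 1, write E for the
    electric field, w = dE/dt, h = S Hy and g = S Hx for the damped magnetic
    fields, a = X E + h and b = Y E + g, where X and Y are the two Kronecker
    difference operators, S the damping matrix, and P the discrete norm.
    Multiplied by P, the second order system reads

      P dw/dt = - X^T P a - Y^T P b - P S w - C w - G E,

    with dHy/dt = - a and dHx/dt = b - g; here C is the boundary dissipation
    and G couples damping and boundary.  The energy is the sum of the squared
    P-norms of w, a, b, h, g, of E^T G E, and of twice the time integral of
    w^T C w.  In its derivative the terms with X, Y, G and C cancel
    ([energy_rate]), and what is left is

      2 (- w^T P S w - a^T P S a - h^T P S a + b^T P S b - g^T P S g).

    As P and S are diagonal with nonnegative entries, completing the square in
    a bounds this by 2 max(sigma) (h^T P h + b^T P b), hence by the energy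
    itself ([damping_le]), since all terms of the energy are nonnegative
    ([wave_energy_ge0]).

    A solution of the first order system solves the second order system
    ([first_order_second_order]): differentiate the equation for E in time;
    the summation-by-parts property identifies the difference operators
    corrected by the boundary penalties with the adjoints that occur in the
    second order form ([sbpD_adjoint]).

    On the analytic side, derivatives are one-sided at the initial time, so
    the few rules of calculus needed are proved for limits along admissible
    increments, including the derivative of the integral term
    ([is_ddt_Rintegral]). *)

(** * One-sided differential calculus on the half line *)

Section OneSidedCalculus.
Context {R : realType}.
Implicit Types (t : R) (V : normedModType R).

Definition ddt_nbhs t : set_system R := within [set h | 0 <= h + t] 0^'.

(** [is_ddt f t l] says that the difference quotient of [f] at [t] converges
    to [l]; the calculus rules are stated on this relation, where [ddt] only
    provides the value of a limit that may not exist. *)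
Definition is_ddt V (f : R -> V) t (l : V) :=
  h^-1 *: (f (h + t) - f t) @[h --> ddt_nbhs t] --> l.

Lemma ddt_nbhs_filter t : Filter (ddt_nbhs t).
Proof. exact: within_filter. Qed.

#[local] Existing Instance ddt_nbhs_filter.

(** Limits along [ddt_nbhs t] are unique because times slightly after [t] are
    always admissible, even when [t] is 0. *)
Lemma ddt_nbhs_proper t : 0 <= t -> ProperFilter (ddt_nbhs t).
Proof.
move=> t0; apply: Build_ProperFilter => -[e /= e0 eA].
have e2 : 0 < e / 2 by rewrite divr_gt0.
apply: (eA (e / 2)) => /=.
- by rewrite sub0r normrN gtr0_norm// ltr_pdivrMr// mulr2n mulrDr mulr1 ltrDl.
- by rewrite gt_eqF.
- by rewrite addr_ge0// ltW.
Qed.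

Lemma ddt_nbhs_cvg0 t : h @[h --> ddt_nbhs t] --> (0 : R).
Proof.
apply: cvg_trans; [exact: cvg_within|exact: nbhs_dnbhs].
Qed.

Lemma ddt_nbhs_neq0 t : \forall h \near ddt_nbhs t, h != 0.
Proof.
by exists 1 => //= h _ h0 _; exact: h0.
Qed.

Lemma ddt_nbhs_ge0 t : \forall h \near ddt_nbhs t, 0 <= h + t.
Proof. by exists 1 => //=. Qed.

Lemma is_ddtP V (f : R -> V) t l :
  0 <= t -> is_ddt f t l -> ddt_derivable f t /\ ddt f t = l.
Proof.
move=> t0 fl; split; first by apply/cvg_ex; exists l.
have FF := ddt_nbhs_proper t0.
by apply: norm_cvg_lim fl.
Qed.

Lemma ddt_derivableP V (f : R -> V) t :
  ddt_derivable f t -> is_ddt f t (ddt f t).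
Proof. exact. Qed.

(** The equations of the systems hold on the half line only, and that is all
    the difference quotients can see.  This is what makes it possible to
    differentiate the equation for the electric field once more. *)
Lemma is_ddt_ext V (f g : R -> V) t l :
  0 <= t -> (forall s, 0 <= s -> f s = g s) -> is_ddt f t l -> is_ddt g t l.
Proof.
move=> t0 fg; apply: cvg_trans; apply: near_eq_cvg.
near=> h; rewrite !fg//.
by near: h; exact: ddt_nbhs_ge0.
Unshelve. all: by end_near. Qed.

Lemma eq_is_ddt V (f g : R -> V) t l :
  f =1 g -> is_ddt f t l -> is_ddt g t l.
Proof. by move=> /funext ->. Qed.

Lemma is_ddtD V (f g : R -> V) t a b :
  is_ddt f t a -> is_ddt g t b -> is_ddt (fun s => f s + g s) t (a + b).
Proof.
move=> fa gb; rewrite /is_ddt.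
under eq_fun do rewrite opprD addrACA scalerDr.
exact: cvgD.
Qed.

Lemma is_ddt_cst V (c : V) t : is_ddt (fun=> c) t 0.
Proof.
rewrite /is_ddt; under eq_fun do rewrite subrr scaler0; exact: cvg_cst.
Qed.

Lemma is_ddt_sum V (I : Type) (r : seq I)
    (f : I -> R -> V) t (a : I -> V) :
  (forall i, is_ddt (f i) t (a i)) ->
  is_ddt (fun s => \sum_(i <- r) f i s) t (\sum_(i <- r) a i).
Proof.
move=> fa; elim: r => [|i r IH].
  by rewrite big_nil; apply: eq_is_ddt (is_ddt_cst 0 t) => s; rewrite big_nil.
rewrite big_cons; apply: eq_is_ddt (is_ddtD (fa i) IH) => s.
by rewrite big_cons.
Qed.

Lemma is_ddtZr V (f : R -> R) t a (v : V) :
  is_ddt f t a -> is_ddt (fun s => f s *: v) t (a *: v).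
Proof.
move=> fa; rewrite /is_ddt.
under eq_fun do rewrite -scalerBl scalerA.
exact: cvgZr_tmp.
Qed.

(** Differentiability implies continuity, from f (h + t) = f t + h q(h) with q
    the difference quotient. *)
Lemma is_ddt_cvg V (f : R -> V) t l :
  is_ddt f t l -> f (h + t) @[h --> ddt_nbhs t] --> f t.
Proof.
move=> fl.
rewrite -[X in _ --> X](addr0 (f t)) -(scale0r l).
apply: cvg_trans (cvgD (cvg_cst (f t)) (cvgZ (@ddt_nbhs_cvg0 t) fl)).
apply: near_eq_cvg; near=> h => /=.
rewrite -[LHS]/(f t + h *: (h^-1 *: (f (h + t) - f t))).
rewrite scalerA divff ?scale1r 1?addrC ?subrK//.
by near: h; exact: ddt_nbhs_neq0.
Unshelve. all: by end_near. Qed.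

Lemma is_ddtM (f g : R -> R) t a b :
  is_ddt f t a -> is_ddt g t b ->
  is_ddt (fun s => f s * g s) t (a * g t + f t * b).
Proof.
move=> fa gb; rewrite /is_ddt.
have -> : (fun h => h^-1 *: (f (h + t) * g (h + t) - f t * g t)) =
  (fun h => (h^-1 *: (f (h + t) - f t)) * g (h + t)
            + f t * (h^-1 *: (g (h + t) - g t))).
  by apply/funext => h; rewrite /GRing.scale /=; ring.
apply: cvgD; first by apply: cvgM => //; exact: is_ddt_cvg gb.
by apply: cvgM => //; exact: cvg_cst.
Qed.

Lemma is_ddt_coord m n (f : R -> 'M[R]_(m, n)) t l i j :
  is_ddt f t l -> is_ddt (fun s => f s i j) t (l i j).
Proof.
move=> fl; rewrite /is_ddt.
have -> : (fun h => h^-1 *: (f (h + t) i j - f t i j)) =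
  (fun M : 'M[R]_(m, n) => M i j) \o (fun h => h^-1 *: (f (h + t) - f t)).
  by apply/funext => h /=; rewrite !mxE.
exact: cvg_comp fl (@coord_continuous _ _ _ _ _ _).
Qed.

(** Writing A v as the combination of the columns of A with the coordinates
    of v reduces the claim to scalar functions. *)
Lemma is_ddt_mulmx m n (A : 'M[R]_(m, n)) (f : R -> 'cV[R]_n) t l :
  is_ddt f t l -> is_ddt (fun s => A *m f s) t (A *m l).
Proof.
move=> fl.
have mulE (v : 'cV[R]_n) : A *m v = \sum_k v k 0 *: col k A.
  by apply/matrixP => i j; rewrite mxE summxE; apply: eq_bigr => k _;
    rewrite !mxE mulrC (ord1 j).
rewrite mulE; apply: eq_is_ddt (fun s => esym (mulE (f s))) _.
by apply: is_ddt_sum => k; apply: is_ddtZr; exact: is_ddt_coord.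
Qed.

Lemma is_ddtN V (f : R -> V) t a :
  is_ddt f t a -> is_ddt (fun s => - f s) t (- a).
Proof.
move=> fa; rewrite /is_ddt.
under eq_fun do rewrite -opprD scalerN.
exact: cvgN.
Qed.

Lemma is_ddtB V (f g : R -> V) t a b :
  is_ddt f t a -> is_ddt g t b -> is_ddt (fun s => f s - g s) t (a - b).
Proof. by move=> fa gb; apply: is_ddtD => //; exact: is_ddtN. Qed.

Lemma derivable_is_ddt (f : R -> R) t l :
  derivable f t 1 -> derive1 f t = l -> is_ddt f t l.
Proof.
move=> df <-; rewrite derive1E.
have {}df : h^-1 *: (f (h + t) - f t) @[h --> 0^'] --> 'D_1 f t.
  by under eq_fun => h do rewrite -[h in f (h + _)]mulr1; exact: df.
apply: cvg_trans df; apply: cvg_app; exact: cvg_within.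
Qed.

(** Freezing [f] at its initial value for negative times turns one-sided
    continuity on the half line into continuity on the whole line; it works
    since clipping at 0 does not increase distances. *)
Lemma is_ddt_continuous (f : R -> R) :
  (forall t, 0 <= t -> exists l, is_ddt f t l) ->
  continuous (fun s : R => f (Num.max s 0)).
Proof.
move=> df t.
have m0 s : 0 <= Num.max s 0 :> R by rewrite le_max lexx orbT.
have [l /is_ddt_cvg/cvgrPdist_lt fl] := df _ (m0 t).
apply/cvgrPdist_lt => e e0.
have [d /= d0 dA] := fl _ e0.
exists d => //= s; rewrite distrC => st.
have hd : `|Num.max s 0 - Num.max t 0| < d.
  apply: le_lt_trans st; have st1 := ler_norm (s - t).
  have := ler_norm (t - s); rewrite distrC => st2.
  by rewrite /Num.max; case: ltP => s0; case: ltP => t0;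
    rewrite ler_norml; apply/andP; split; lra.
have [->|h0] := eqVneq (Num.max s 0) (Num.max t 0); first by rewrite subrr normr0.
have := dA (Num.max s 0 - Num.max t 0); rewrite /= sub0r normrN subr_eq0 subrK => dA'.
by rewrite distrC; exact: dA'.
Qed.

(** The fundamental theorem of calculus up to the endpoint 0: the integrand is
    replaced by its continuous extension to negative times, and the primitive
    based at -1 is then differentiable around 0. *)
Lemma is_ddt_Rintegral (f : R -> R) t :
  0 <= t -> (forall s, 0 <= s -> exists l, is_ddt f s l) ->
  is_ddt (fun s => \int[lebesgue_measure]_(u in `[0, s]) f u) t (f t).
Proof.
move=> t0 df.
pose g (s : R) := f (Num.max s 0).
have g_cont : continuous g by exact: is_ddt_continuous.
have g_int a b : lebesgue_measure.-integrable `[a, b] (EFin \o g).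
  apply: continuous_compact_integrable; first exact: segment_compact.
  exact: continuous_subspaceT.
pose G s := \int[lebesgue_measure]_(u in `[(-1), s]) g u.
have [dG Gt] : derivable G t 1 /\ derive1 G t = g t.
  apply: (@continuous_FTC1 _ g (BLeft (-1)) t (t + 1)) => //.
  - by rewrite ltrDl.
  - by rewrite lte_fin; lra.
  - exact: g_cont.
have gE s : 0 <= s -> g s = f s by rewrite /g => /max_idPl ->.
rewrite -(gE t t0).
apply: (@is_ddt_ext _ (fun s => G s - G 0)) => //; last first.
  rewrite -[X in is_ddt _ _ X]subr0; apply: is_ddtB; last exact: is_ddt_cst.
  exact: derivable_is_ddt.
move=> s s0; rewrite /G Rintegral_itvB//; last first.
  by rewrite bnd_simp; lra.
rewrite Rintegral_itv_obnd_cbnd//; last first.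
  by apply: (integrableS _ _ _ (g_int 0 s)) => //; exact: subset_itv_oc_cc.
apply: eq_Rintegral => u; rewrite inE/= in_itv/= => /andP[u0 _].
exact: gE.
Qed.

End OneSidedCalculus.

Arguments is_ddt_mulmx {R m n} A {f t l}.

(** * Nonnegative diagonal matrices and their quadratic forms *)

Section DiagonalForms.
Context {R : realType}.

(** All the weights of the energy (norm, damping and boundary matrices) are of
    this kind; unlike general positive semidefinite matrices, these are closed
    under products, and inequalities between their forms can be checked
    coordinate by coordinate. *)
Definition diag_nneg n (A : 'M[R]_n) := is_diag_mx A /\ forall i, 0 <= A i i.

Definition dot n (u v : 'cV[R]_n) : R := (u^T *m v) 0 0.

Lemma dotE n (u v : 'cV[R]_n) : dot u v = \sum_i u i 0 * v i 0.
Proof. by rewrite /dot mxE; apply: eq_bigr => i _; rewrite mxE. Qed.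

Lemma dotC n (u v : 'cV[R]_n) : dot u v = dot v u.
Proof. by rewrite !dotE; apply: eq_bigr => i _; rewrite mulrC. Qed.

Lemma dotDr n (u v w : 'cV[R]_n) : dot u (v + w) = dot u v + dot u w.
Proof. by rewrite /dot mulmxDr mxE. Qed.

Lemma dotNr n (u v : 'cV[R]_n) : dot u (- v) = - dot u v.
Proof. by rewrite /dot mulmxN mxE. Qed.

Lemma dot_mulmxl n (A : 'M[R]_n) (u v : 'cV[R]_n) :
  dot (A *m u) v = dot u (A^T *m v).
Proof. by rewrite /dot trmx_mul mulmxA. Qed.

Lemma qformE n (A : 'M[R]_n) u : qform A u = dot u (A *m u).
Proof. by rewrite /qform /dot mulmxA. Qed.

Lemma is_diag_mx_tr n (A : 'M[R]_n) : is_diag_mx A -> A^T = A.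
Proof. by case/diag_mxP => d ->; rewrite tr_diag_mx. Qed.

Lemma is_diag_mulmxE n (A : 'M[R]_n) (u : 'cV[R]_n) i :
  is_diag_mx A -> (A *m u) i 0 = A i i * u i 0.
Proof. by case/diag_mxP => d ->; rewrite mul_diag_mx !mxE eqxx mulr1n. Qed.

Lemma diag_mulC n (A B : 'M[R]_n) :
  is_diag_mx A -> is_diag_mx B -> A *m B = B *m A.
Proof. by case/diag_mxP => d -> /diag_mxP[e ->]; rewrite diag_mxC. Qed.

Lemma qform_diag n (A : 'M[R]_n) (u : 'cV[R]_n) :
  is_diag_mx A -> qform A u = \sum_i A i i * u i 0 ^+ 2.
Proof.
move=> dA; rewrite qformE dotE; apply: eq_bigr => i _.
by rewrite is_diag_mulmxE//; ring.
Qed.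

Lemma qform_ge0 n (A : 'M[R]_n) (u : 'cV[R]_n) :
  diag_nneg A -> 0 <= qform A u.
Proof.
move=> [dA A0]; rewrite qform_diag//; apply: sumr_ge0 => i _.
by rewrite mulr_ge0// sqr_ge0.
Qed.

Lemma diag_nnegD n (A B : 'M[R]_n) :
  diag_nneg A -> diag_nneg B -> diag_nneg (A + B).
Proof.
move=> [/is_diag_mxP dA A0] [/is_diag_mxP dB B0]; split.
  by apply/is_diag_mxP => i j ij; rewrite mxE dA ?dB ?addr0.
by move=> i; rewrite mxE addr_ge0.
Qed.

Lemma diag_nnegM n (A B : 'M[R]_n) :
  diag_nneg A -> diag_nneg B -> diag_nneg (A *m B).
Proof.
move=> [/diag_mxP[d ->] A0] [/diag_mxP[e ->] B0]; split.
  by rewrite mulmx_diag diag_mx_is_diag.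
move=> i; have := A0 i; have := B0 i.
by rewrite mulmx_diag !mxE eqxx !mulr1n => *; rewrite mulr_ge0.
Qed.

Lemma diag_nneg1 n : diag_nneg (1%:M : 'M[R]_n).
Proof. by split=> [|i]; rewrite ?scalar_mx_is_diag// mxE ler0n. Qed.

Lemma diag_nneg_diag_mx n (d : 'rV[R]_n) :
  (forall i, 0 <= d 0 i) -> diag_nneg (diag_mx d).
Proof.
by move=> d0; split=> [|i]; rewrite ?diag_mx_is_diag// mxE eqxx mulr1n.
Qed.

Lemma diag_nneg_tens m n (A : 'M[R]_m) (B : 'M[R]_n) :
  diag_nneg A -> diag_nneg B -> diag_nneg (A *t B).
Proof.
move=> [/is_diag_mxP dA A0] [/is_diag_mxP dB B0]; split; last first.
  by move=> i; rewrite mxE mulr_ge0.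
apply/is_diag_mxP => i j.
case: (mxtens_indexP i) => i1 i2; case: (mxtens_indexP j) => j1 j2 ij.
rewrite tensmxE; have [e1|e1] := eqVneq (i1 : nat) j1; last by rewrite dA ?mul0r.
have [e2|e2] := eqVneq (i2 : nat) j2; last by rewrite dB ?mulr0.
by move: ij; rewrite /= e1 e2 eqxx.
Qed.

Lemma is_ddt_dot n (u v : R -> 'cV[R]_n) t a b :
  is_ddt u t a -> is_ddt v t b ->
  is_ddt (fun s => dot (u s) (v s)) t (dot a (v t) + dot (u t) b).
Proof.
move=> ua vb; rewrite !dotE -big_split/=.
apply: eq_is_ddt (fun s => esym (dotE (u s) (v s))) _.
by apply: is_ddt_sum => i; apply: is_ddtM; exact: is_ddt_coord.
Qed.

Lemma is_ddt_qform n (A : 'M[R]_n) (u : R -> 'cV[R]_n) t a :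
  is_diag_mx A -> is_ddt u t a ->
  is_ddt (fun s => qform A (u s)) t (2 * dot (u t) (A *m a)).
Proof.
move=> dA ua; apply: eq_is_ddt (fun s => esym (qformE A (u s))) _.
have -> : 2 * dot (u t) (A *m a) = dot a (A *m u t) + dot (u t) (A *m a).
  by rewrite (dotC a) dot_mulmxl is_diag_mx_tr//; ring.
by apply: is_ddt_dot => //; exact: is_ddt_mulmx.
Qed.

Section EnergyEstimate.
Context (n : nat) (P S C G X Y : 'M[R]_n) (smax : R).
Hypotheses (P_nneg : diag_nneg P) (S_nneg : diag_nneg S).
Hypotheses (C_nneg : diag_nneg C) (G_nneg : diag_nneg G).
Hypothesis (S_le : forall i, S i i <= smax).
Hypothesis smax_ge0 : 0 <= smax.

(** The energy of a damped wave system with difference operators X and Y, norm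
    matrix P, damping S, boundary dissipation C and boundary-damping
    coupling G. *)
Definition wave_energy (E Hy Hx : R -> 'cV[R]_n) (t : R) : R :=
  qform P (ddt E t) + qform P (X *m E t + S *m Hy t)
  + qform P (Y *m E t + S *m Hx t) + qform P (S *m Hy t)
  + qform P (S *m Hx t) + qform G (E t)
  + 2 * \int[lebesgue_measure]_(s in `[0, t]) qform C (ddt E s).

Lemma wave_energy_ge0 E Hy Hx t : 0 <= wave_energy E Hy Hx t.
Proof.
rewrite /wave_energy !addr_ge0 ?qform_ge0// mulr_ge0//.
by apply: Rintegral_ge0 => s _; exact: qform_ge0.
Qed.

(** The left-hand side is half of the energy rate (see [energy_rate]).  At
    each grid point, with p and s the entries of P and S, the products combine
    to - a^2 - h a <= h^2 / 4, so at most p s (b^2 + h^2 / 4) is left, and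
    s <= smax. *)
Lemma damping_le (w a b h g : 'cV[R]_n) :
  - dot w (P *m (S *m w)) - dot a (P *m (S *m a)) - dot h (P *m (S *m a))
  + dot b (P *m (S *m b)) - dot g (P *m (S *m g))
  <= smax * (qform P w + qform P a + qform P b + qform P h + qform P g).
Proof.
case: P_nneg S_nneg => dP P0 [dS S0].
have formE (u v : 'cV[R]_n) :
    dot u (P *m (S *m v)) = \sum_i P i i * S i i * (u i 0 * v i 0).
  by rewrite dotE; apply: eq_bigr => i _; rewrite !is_diag_mulmxE//; ring.
rewrite !formE !qform_diag// -!sumrN -!big_split/= mulr_sumr.
apply: ler_sum => i _.
have p0 := P0 i; have s0 := S0 i; have s1 := S_le i.
set p := P i i in p0 *; set s := S i i in s0 s1 *.
set w1 := w i 0; set a1 := a i 0; set b1 := b i 0.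
set h1 := h i 0; set g1 := g i 0.
have ps0 : 0 <= p * s by rewrite mulr_ge0.
have ps1 : 0 <= p * (smax - s) by rewrite mulr_ge0// subr_ge0.
have ps2 : 0 <= p * smax by rewrite mulr_ge0.
have sq := sqr_ge0.
(* Completing the square absorbs the indefinite product a h. *)
have q1 := mulr_ge0 ps0 (sq _ (a1 + h1 / 2)).
have q2 := mulr_ge0 ps0 (sq _ w1).
have q3 := mulr_ge0 ps0 (sq _ g1).
have q4 := mulr_ge0 ps1 (sq _ b1).
have q5 := mulr_ge0 ps1 (sq _ h1).
have q6 := mulr_ge0 ps2 (sq _ w1).
have q7 := mulr_ge0 ps2 (sq _ a1).
have q8 := mulr_ge0 ps2 (sq _ g1).
have q9 := mulr_ge0 ps0 (sq _ h1).
lra.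
Qed.

(** Half of the time derivative of the energy, where w = dE/dt,
    a = X E + S Hy, b = Y E + S Hx, h = S Hy, g = S Hx, so that dHy/dt = - a
    and dHx/dt = Y E = b - g.  The operator terms cancel since X^T P and Y^T P
    are the adjoints of P X and P Y, the G terms cancel by symmetry, and the
    dissipation w^T C w is compensated by the derivative of the time integral;
    only damping terms survive. *)
Lemma energy_rate (e w w' a b h g : 'cV[R]_n) :
  P *m w' = - (X^T *m (P *m a)) - Y^T *m (P *m b) - P *m (S *m w)
            - C *m w - G *m e ->
  dot w (P *m w') + dot a (P *m (X *m w - S *m a))
  + dot b (P *m (Y *m w + S *m (b - g))) + dot h (P *m - (S *m a))
  + dot g (P *m (S *m (b - g))) + dot e (G *m w) + dot w (C *m w)
  = - dot w (P *m (S *m w)) - dot a (P *m (S *m a)) - dot h (P *m (S *m a))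
    + dot b (P *m (S *m b)) - dot g (P *m (S *m g)).
Proof.
case: P_nneg S_nneg G_nneg => dP _ [dS _] [dG _] ->.
have PX : dot a (P *m (X *m w)) = dot w (X^T *m (P *m a)).
  by rewrite [RHS]dotC dot_mulmxl trmxK [RHS]dot_mulmxl is_diag_mx_tr.
have PY : dot b (P *m (Y *m w)) = dot w (Y^T *m (P *m b)).
  by rewrite [RHS]dotC dot_mulmxl trmxK [RHS]dot_mulmxl is_diag_mx_tr.
have Gew : dot e (G *m w) = dot w (G *m e).
  by rewrite [RHS]dotC dot_mulmxl is_diag_mx_tr.
have PSgb : dot g (P *m (S *m b)) = dot b (P *m (S *m g)).
  rewrite [RHS]dotC dot_mulmxl dot_mulmxl !is_diag_mx_tr//.
  by rewrite !mulmxA (diag_mulC dS dP).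
rewrite !(mulmxDr, mulmxN, dotDr, dotNr) PX PY Gew PSgb.
ring.
Qed.

(** The rate is bounded by 2 smax times the five squared norms of the energy,
    and its two other terms are nonnegative, so they can be added to the
    bound. *)
Lemma wave_energy_estimate (E Hy Hx : R -> 'cV[R]_n) :
  (forall t, 0 <= t ->
    [/\ ddt_derivable E t, ddt_derivable (ddt E) t, ddt_derivable Hy t
      & ddt_derivable Hx t] /\
    [/\ P *m ddt (ddt E) t =
          - (X^T *m (P *m (X *m E t + S *m Hy t)))
          - Y^T *m (P *m (Y *m E t + S *m Hx t))
          - P *m (S *m ddt E t) - C *m ddt E t - G *m E t,
        ddt Hy t = - (X *m E t) - S *m Hy t
      & ddt Hx t = Y *m E t]) ->
  forall t, 0 <= t ->
    ddt_derivable (wave_energy E Hy Hx) t /\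
    ddt (wave_energy E Hy Hx) t <= 2 * smax * wave_energy E Hy Hx t.
Proof.
move=> sys t t0.
have [[dE dW dHy dHx] [PW HyE HxE]] := sys t t0.
have EW : is_ddt E t (ddt E t) := ddt_derivableP dE.
have WW : is_ddt (ddt E) t (ddt (ddt E) t) := ddt_derivableP dW.
set a := X *m E t + S *m Hy t; set b := Y *m E t + S *m Hx t.
set h := S *m Hy t; set g := S *m Hx t.
have dh : is_ddt (fun s => S *m Hy s) t (- (S *m a)).
  rewrite -mulmxN; apply: is_ddt_mulmx.
  have -> : - a = ddt Hy t by rewrite HyE opprD.
  exact: dHy.
have dg : is_ddt (fun s => S *m Hx s) t (S *m (b - g)).
  apply: is_ddt_mulmx; rewrite /b addrK -HxE; exact: dHx.
have da : is_ddt (fun s => X *m E s + S *m Hy s) t (X *m ddt E t - S *m a).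
  by apply: is_ddtD dh; exact: is_ddt_mulmx _ EW.
have db : is_ddt (fun s => Y *m E s + S *m Hx s) t
                 (Y *m ddt E t + S *m (b - g)).
  by apply: is_ddtD dg; exact: is_ddt_mulmx _ EW.
have dint : is_ddt (fun s => \int[lebesgue_measure]_(r in `[0, s])
    qform C (ddt E r)) t (qform C (ddt E t)).
  apply: (is_ddt_Rintegral (f := fun s => qform C (ddt E s))) => // s s0.
  have [[_ dWs _ _] _] := sys s s0.
  by eexists; apply: is_ddt_qform; [case: C_nneg|exact: dWs].
have dP : is_diag_mx P by case: P_nneg.
have dG : is_diag_mx G by case: G_nneg.
have dEn := is_ddtD (is_ddtD (is_ddtD (is_ddtD (is_ddtD (is_ddtD
  (is_ddt_qform dP WW) (is_ddt_qform dP da)) (is_ddt_qform dP db))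
  (is_ddt_qform dP dh)) (is_ddt_qform dP dg)) (is_ddt_qform dG EW))
  (is_ddtM (is_ddt_cst (2 : R) t) dint).
have [dEn1 ->] := is_ddtP t0 dEn; split => //.
have := energy_rate h g PW.
have := damping_le (ddt E t) a b h g.
rewrite mul0r add0r (qformE C) -/a -/b -/h -/g.
have rest : 0 <= smax * (qform G (E t) +
   2 * \int[lebesgue_measure]_(s in `[0, t]) qform C (ddt E s)).
  rewrite mulr_ge0// addr_ge0 ?qform_ge0// mulr_ge0//.
  by apply: Rintegral_ge0 => s _; exact: qform_ge0.
rewrite /wave_energy -/a -/b -/h -/g => dle rate; move: rest dle rate.
(* What remains is linear in the forms; naming them keeps [lra] from comparing
   matrix products up to conversion. *)
move: (\int[_]_(_ in _) _) => I; do !move: (dot _ _) => ?.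
by do !move: (qform _ _) => ?; lra.
Qed.

End EnergyEstimate.
End DiagonalForms.

(** * Summation-by-parts operators and the two discrete systems *)

Section SummationByParts.
Context {R : realType}.

(** Positive definiteness tested on a basis vector. *)
Lemma sbpP_entry_gt0 N (S : sbp R N) i : 0 < sbpP S i i.
Proof.
have [_ /(_ (delta_mx i 0))] := sbpP_posdef S.
rewrite trmx_delta -rowE -colE !mxE; apply; apply/negP => /eqP/matrixP/(_ i 0).
by rewrite !mxE !eqxx => /eqP; rewrite oner_eq0.
Qed.

Lemma sbpP_unit N (S : sbp R N) : sbpP S \in unitmx.
Proof.
have := sbpP_entry_gt0 S; case/diag_mxP: (sbpP_diag S) => d -> d0.
rewrite unitmxE det_diag unitfE; apply/prodf_neq0 => i _.
by have := d0 i; rewrite mxE eqxx mulr1n => /lt0r_neq0.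
Qed.

Lemma sbpP_nneg N (S : sbp R N) : diag_nneg (sbpP S).
Proof. by split=> [|i]; [exact: sbpP_diag|exact/ltW/sbpP_entry_gt0]. Qed.

Lemma EL_nneg N : diag_nneg (EL R N).
Proof. by apply: diag_nneg_diag_mx => i; rewrite mxE ler0n. Qed.

Lemma ER_nneg N : diag_nneg (ER R N).
Proof. by apply: diag_nneg_diag_mx => i; rewrite mxE ler0n. Qed.

Lemma Bplus_nneg N : diag_nneg (Bplus R N).
Proof. by apply: diag_nnegD; [exact: ER_nneg|exact: EL_nneg]. Qed.

(** The penalty P^-1 B^- turns - D into P^-1 D^T P, the adjoint of D in the
    discrete inner product: this is discrete integration by parts, obtained
    from P D = Q and Q + Q^T = B^-. *)
Lemma sbpD_adjoint N (S : sbp R N) :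
  invmx (sbpP S) *m Bminus R N - sbpD S
  = invmx (sbpP S) *m (sbpD S)^T *m sbpP S.
Proof.
have QE : (sbpD S)^T *m sbpP S = (sbpQ S)^T.
  rewrite -[X in _ *m X](sbpP_posdef S).1 -trmx_mul /sbpD.
  by rewrite mulKVmx// sbpP_unit.
rewrite -mulmxA QE /Bminus -(sbpQ_sbp S) /sbpD -mulmxBr; congr (_ *m _).
by rewrite addrAC subrr add0r.
Qed.

Lemma tensmxBl m n (A B : 'M[R]_m) (C : 'M[R]_n) :
  (A - B) *t C = A *t C - B *t C.
Proof. by apply/matrixP => i j; rewrite !mxE mulrBl. Qed.

Lemma tensmxBr m n (A B : 'M[R]_m) (C : 'M[R]_n) :
  C *t (A - B) = C *t A - C *t B.
Proof. by apply/matrixP => i j; rewrite !mxE mulrBr. Qed.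

Context (Nx Ny : nat) (Sx : sbp R Nx) (Sy : sbp R Ny).
Context (sigma : R -> R) (x : 'I_Nx -> R).

(** The damping acts on the x index and A on the y index. *)
Lemma damp_comm (A : 'M[R]_Ny) :
  damp Ny sigma x *m (1%:M *t A) = (1%:M *t A) *m damp Ny sigma x.
Proof. by rewrite /damp !tensmx_mul !mulmx1 !mul1mx. Qed.

(** Differentiate the equation for the electric field and substitute the other
    equations.  By [sbpD_adjoint] the penalties on the magnetic fields turn
    the difference operators into their adjoints, and in the auxiliary
    equation a fraction theta of the y penalty is available for this, which
    leaves the (1 - theta) term. *)
Lemma first_order_second_order theta (Ez Hy Hx Hxs : R -> 'cV[R]_(Nx * Ny)) :
  first_order_system Sx Sy sigma x theta Ez Hy Hx Hxs ->
  second_order_system Sx Sy sigma x theta Ez Hy Hx.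
Proof.
move=> sys t t0; have [[dE dHy dHx dHs] [_ HyE HxE HsE]] := sys t t0.
have sbpX : (invmx (sbpP Sx) *m Bminus R Nx) *t (1%:M : 'M[R]_Ny)
    = sbpD Sx *t 1%:M
      + ((invmx (sbpP Sx) *m (sbpD Sx)^T) *t 1%:M) *m (sbpP Sx *t 1%:M).
  by rewrite tensmx_mul mulmx1 -sbpD_adjoint tensmxBl addrC subrK.
have sbpY : (1%:M : 'M[R]_Nx) *t (invmx (sbpP Sy) *m Bminus R Ny)
    = 1%:M *t sbpD Sy
      + (1%:M *t (invmx (sbpP Sy) *m (sbpD Sy)^T)) *m (1%:M *t sbpP Sy).
  by rewrite tensmx_mul mulmx1 -sbpD_adjoint tensmxBr addrC subrK.
have commTY : damp Ny sigma x
      *m ((1%:M *t (invmx (sbpP Sy) *m (sbpD Sy)^T)) *m (1%:M *t sbpP Sy))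
    = ((1%:M *t (invmx (sbpP Sy) *m (sbpD Sy)^T)) *m (1%:M *t sbpP Sy))
      *m damp Ny sigma x.
  by rewrite tensmx_mul mulmx1 damp_comm.
move: sbpX sbpY commTY HyE HxE HsE.
have {sys} sysE s (s0 : 0 <= s) := let: conj _ (And4 e _ _ _) := sys s s0 in e.
move: sysE.
(* From here on only the two adjoint relations and the commutation matter, so
   the Kronecker products become variables. *)
set X := sbpD Sx *t 1%:M; set Y := 1%:M *t sbpD Sy.
set BXm := (invmx (sbpP Sx) *m Bminus R Nx) *t 1%:M.
set BXp := (invmx (sbpP Sx) *m Bplus R Nx) *t 1%:M.
set BYm := 1%:M *t (invmx (sbpP Sy) *m Bminus R Ny).
set BYp := 1%:M *t (invmx (sbpP Sy) *m Bplus R Ny).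
set TX := _ *m (sbpP Sx *t _); set TY := _ *m (_ *t sbpP Sy).
set S := damp Ny sigma x.
move: X Y BXm BXp BYm BYp TX TY S => X Y BXm BXp BYm BYp TX TY S.
move=> sysE sbpX sbpY commTY HyE HxE HsE.
have [iE iHy iHx iHs] := And4 (ddt_derivableP dE) (ddt_derivableP dHy)
  (ddt_derivableP dHx) (ddt_derivableP dHs).
have dRHS := is_ddtB (is_ddtB (is_ddtB
  (is_ddtD (is_ddtD (is_ddtN (is_ddt_mulmx X iHy)) (is_ddt_mulmx Y iHx)) iHs)
  (is_ddt_mulmx S iE)) (is_ddtB (is_ddt_mulmx BXp iE) (is_ddt_mulmx BXm iHy)))
  (is_ddtD (is_ddt_mulmx BYp iE) (is_ddt_mulmx BYm iHx)).
have ddE := is_ddt_ext t0 (fun s s0 => esym (sysE s s0)) dRHS.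
have [ddE1 ddE2] := is_ddtP t0 ddE.
split; first by [].
split=> //; rewrite ddE2 HsE sbpX sbpY HyE HxE.
rewrite !(mulmxDl, mulmxDr, mulmxN, scalerDr, scalerN, =^~ scalemxAr, =^~ mulmxA).
have commv v : S *m (TY *m v) = TY *m (S *m v) by rewrite !mulmxA commTY.
rewrite !commv.
do !move: (_ *m _) => ?.
by apply/matrixP => i j; rewrite !mxE; ring.
Qed.

(** Multiplying by the norm matrix removes all inverses and puts the wave
    equation in the symmetric form used by [wave_energy_estimate]. *)
Lemma second_order_weighted (Ez Hy Hx : R -> 'cV[R]_(Nx * Ny)) t :
  second_order_system Sx Sy sigma x 1 Ez Hy Hx -> 0 <= t ->
  let P := sbpP Sx *t sbpP Sy in let S := damp Ny sigma x in
  let X := sbpD Sx *t 1%:M in let Y := 1%:M *t sbpD Sy in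
  P *m ddt (ddt Ez) t =
    - (X^T *m (P *m (X *m Ez t + S *m Hy t)))
    - Y^T *m (P *m (Y *m Ez t + S *m Hx t))
    - P *m (S *m ddt Ez t)
    - (Bplus R Nx *t sbpP Sy + sbpP Sx *t Bplus R Ny) *m ddt Ez t
    - ((sbpP Sx *m dampx sigma x) *t Bplus R Ny) *m Ez t.
Proof.
move=> sys t0 P S X Y; have [_ [-> _ _]] := sys t t0.
have [uPx uPy] := (sbpP_unit Sx, sbpP_unit Sy).
rewrite subrr scale0r addr0 scale1r -/S.
set a := X *m Ez t + _; set b := Y *m Ez t + _.
move: a b => a b.
rewrite !(mulmxBr, mulmxN).
rewrite /P /S /X /Y /damp !mulmxA !trmx_tens !trmx1.
by rewrite !tensmx_mul mulmxDr !tensmx_mul !mulmx1 !mulmxA !mulmxV// !mul1mx.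
Qed.

Lemma damp_nneg : (forall i, 0 <= sigma (x i)) -> diag_nneg (damp Ny sigma x).
Proof.
move=> s0; apply: diag_nneg_tens (diag_nneg1 _).
by apply: diag_nneg_diag_mx => i; rewrite mxE.
Qed.

Lemma damp_le (smax : R) k :
  (forall i, sigma (x i) <= smax) -> damp Ny sigma x k k <= smax.
Proof.
move=> s_le; case: (mxtens_indexP k) => i j.
by rewrite /damp tensmxE !mxE !eqxx mulr1n mulr1.
Qed.

Lemma energy1E (Ez Hy Hx : R -> 'cV[R]_(Nx * Ny)) :
  energy1 Sx Sy sigma x 1 Ez Hy Hx =
  wave_energy (sbpP Sx *t sbpP Sy) (damp Ny sigma x)
    (Bplus R Nx *t sbpP Sy + sbpP Sx *t Bplus R Ny)
    ((sbpP Sx *m dampx sigma x) *t Bplus R Ny)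
    (sbpD Sx *t 1%:M) (1%:M *t sbpD Sy) Ez Hy Hx.
Proof. by apply/funext => t; rewrite /energy1 mul1r. Qed.

End SummationByParts.

Theorem theorem5p1 (R : realType) (Nx Ny : nat)
    (hNx : (2 <= Nx)%N) (hNy : (2 <= Ny)%N)
    (Sx : sbp R Nx) (Sy : sbp R Ny)
    (X : set R) (x : 'I_Nx -> R) (hx : forall i, X (x i))
    (sigma : R -> R) (hsigma : forall z, X z -> 0 <= sigma z)
    (sigma_inf : R)
    (hsigma_inf : (sigma @` X) sigma_inf /\ ubound (sigma @` X) sigma_inf)
    (theta : R) (htheta : theta = 1) :
  (forall (Ez Hy Hx : R -> 'cV[R]_(Nx * Ny)) (t : R), 0 <= t ->
     0 <= energy1 Sx Sy sigma x theta Ez Hy Hx t) /\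
  (forall Ez Hy Hx : R -> 'cV[R]_(Nx * Ny),
     (exists Hxs : R -> 'cV[R]_(Nx * Ny),
        first_order_system Sx Sy sigma x theta Ez Hy Hx Hxs) \/
     second_order_system Sx Sy sigma x theta Ez Hy Hx ->
     forall t : R, 0 <= t ->
       let energy := energy1 Sx Sy sigma x theta Ez Hy Hx in
       ddt_derivable energy t /\
       ddt energy t <= 2 * sigma_inf * energy t).

Proof.
case: hsigma_inf => -[z Xz sz] /ubP s_ub.
have s0 i : 0 <= sigma (x i) by exact/hsigma/hx.
have s_le i : sigma (x i) <= sigma_inf by apply: s_ub; exists (x i).
have smax0 : 0 <= sigma_inf by rewrite -sz; exact: hsigma.
have Px0 := sbpP_nneg Sx; have Py0 := sbpP_nneg Sy.
have Bx0 := @Bplus_nneg R Nx; have By0 := @Bplus_nneg R Ny.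
have P0 := diag_nneg_tens Px0 Py0.
have S0 := damp_nneg Ny s0.
have C0 := diag_nnegD (diag_nneg_tens Bx0 Py0) (diag_nneg_tens Px0 By0).
have G0 : diag_nneg ((sbpP Sx *m dampx sigma x) *t Bplus R Ny).
  apply: diag_nneg_tens By0; apply: diag_nnegM => //.
  by apply: diag_nneg_diag_mx => i; rewrite mxE.
rewrite htheta; split=> [Ez Hy Hx t _|Ez Hy Hx sys t t0 /=].
  by rewrite energy1E; exact: wave_energy_ge0.
rewrite energy1E; apply: wave_energy_estimate => // [k|{}t {}t0].
  exact: damp_le.
have {}sys : second_order_system Sx Sy sigma x 1 Ez Hy Hx.
  by case: sys => // -[Hxs]; exact: first_order_second_order.
have [ders [_ HyE HxE]] := sys t t0.
by split=> //; split=> //; exact: second_order_weighted.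
Qed.
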